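(* Let $\rho$ be a left-linear constrained rewrite rule. If $\Pi X.\,s\,[\varphi]\to_\rho\Pi Y.\,t\,[\varphi]$ is a rewrite step of non-quantified constrained terms, then there is an existentially constrained term $u$ with $\mathrm{ext}(\Pi X.\,s\,[\varphi])\to_\rho u$ (a most general rewrite step) and $\mathrm{ext}(\Pi Y.\,t\,[\varphi])\sqsubseteq u$.
   Context: Fix a many-sorted signature whose sorts are partitioned into theory sorts and term sorts and whose function symbols are partitioned into theory symbols (all argument and result sorts are theory sorts) and term symbols; there is a theory sort $\mathsf{Bool}$. $\mathrm{Var}(t_1,\dots,t_n)$ is the set of variables in the $t_i$; $s|_p$, $s[u]_p$ as usual. A fixed model $\mathcal{M}$ interprets theory sorts by nonempty sets and theory symbols by functions, with $\mathsf{Bool}=\{\mathsf{true},\mathsf{false}\}$ and standard connectives and equalities; every element of every interpreted sort is a constant theory symbol, called a value; $\mathrm{Val}$ is the set of values. A logical constraint is a $\mathsf{Bool}$-sorted term of theory symbols and variables; $\models_{\mathcal{M},\xi}\varphi$ (valuation $\xi$) and $\models_{\mathcal{M}}\varphi$ (all valuations) as usual. Substitutions are sort-preserving, $\mathrm{Dom}(\sigma)=\{x\mid\sigma(x)\ne x\}$, $\sigma$ is $X$-valued if $\sigma(X)\subseteq\mathrm{Val}$. Existential constraint $\exists\vec x.\varphi$: $\{\vec x\}\subseteq\mathrm{Var}(\varphi)$, $\mathrm{FVar}=\mathrm{Var}(\varphi)\setminus\{\vec x\}$; $\models_{\mathcal{M},\xi}\exists\vec x.\varphi$ iff some values $\vec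 v$ give $\models_{\mathcal{M},\xi}\varphi\{\vec x\mapsto\vec v\}$; valid/satisfiable: for all/some $\xi$. $\sigma\models_{\mathcal{M}}\exists\vec x.\varphi$ means $\sigma(\mathrm{FVar}(\exists\vec x.\varphi))\subseteq\mathrm{Val}$ and $\models_{\mathcal{M}}(\exists\vec x.\varphi)\sigma$. An existentially constrained term $\Pi X.s[\exists\vec x.\varphi]$ requires $\mathrm{FVar}(\exists\vec x.\varphi)\subseteq X\subseteq\mathrm{Var}(s)$ and $\{\vec x\}\cap\mathrm{Var}(s)=\emptyset$; satisfiable if its constraint is. Subsumption: $\Pi X.s[\exists\vec x.\varphi]\sqsubseteq\Pi Y.t[\exists\vec y.\psi]$ iff for every $X$-valued $\sigma$ with $\sigma\models_{\mathcal{M}}\exists\vec x.\varphi$ there is a $Y$-valued $\gamma$ with $\gamma\models_{\mathcal{M}}\exists\vec y.\psi$ and $s\sigma=t\gamma$. A constrained rewrite rule $\rho:\Pi Z.\ell\to r[\pi]$: $\ell,r$ terms of the same sort, $\pi$ a logical constraint, $(\mathrm{Var}(r)\setminus\mathrm{Var}(\ell))\cup\mathrm{Var}(\pi)\subseteq Z\subseteq\mathrm{Var}(\ell,r,\pi)=\mathrm{Var}(\rho)$; left-linear if $\ell$ is linear; $\mathrm{ExVar}(\rho)=\mathrm{Var}(r)\setminus\mathrm{Var}(\ell)$. Most general rewrite step: for satisfiable $\Pi X.s[\exists\vec x.\varphi]$ and left-linear $\rho$ with $\mathrm{Var}(\rho)\cap\mathrm{Var}(s,\varphi)=\emptyset$,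 if $p\in\mathrm{Pos}(s)$ and $\gamma$ satisfy $\mathrm{Dom}(\gamma)=\mathrm{Var}(\ell)$, $s|_p=\ell\gamma$, $\gamma(x)\in\mathrm{Val}\cup X$ for all $x\in\mathrm{Var}(\ell)\cap Z$, and $\models_{\mathcal{M}}(\exists\vec x.\varphi)\Rightarrow(\exists\vec z.\pi\gamma)$ with $\{\vec z\}=\mathrm{Var}(\pi)\setminus\mathrm{Var}(\ell)$, then $\Pi X.s[\exists\vec x.\varphi]\to_\rho\Pi Y.t[\exists\vec y.\psi]$ with $t=s[r\gamma]_p$, $\psi=\varphi\land\pi\gamma$, $\{\vec y\}=\mathrm{Var}(\psi)\setminus\mathrm{Var}(t)$, $Y=\mathrm{ExVar}(\rho)\cup(X\cap\mathrm{Var}(t))$. Non-quantified constrained terms: $\Pi X.s[\varphi]$ with $X$ a set of variables, $s$ a term, $\varphi$ a logical constraint, $\mathrm{Var}(\varphi)\subseteq X\subseteq\mathrm{Var}(\varphi,s)$; satisfiable if $\varphi$ is. Rewriting: for satisfiable $\Pi X.s[\varphi]$ and a rule $\rho$ with $\mathrm{Var}(\rho)\cap(X\cup\mathrm{Var}(s,\varphi))=\emptyset$, $\Pi X.s[\varphi]\to_\rho\Pi Y.t[\varphi]$ if there are a position $p$ of $s$ at which a function symbol occurs and a substitution $\sigma$ with $\mathrm{Dom}(\sigma)=\mathrm{Var}(\ell,r,\pi)$, $\ell\sigma=s|_p$, $\sigma(x)\in\mathrm{Val}\cup X$ for all $x\in Z$, $\models_{\mathcal{M}}\varphi\Rightarrow\pi\sigma$,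 where $t=s[r\sigma]_p$ and $Y=X\cap\mathrm{Var}(t,\varphi)$. The existential extension is $\mathrm{ext}(\Pi X.s[\varphi])=\Pi(X\setminus\{\vec x\}).s[\exists\vec x.\varphi]$ where $\{\vec x\}=\mathrm{Var}(\varphi)\setminus\mathrm{Var}(s)$. *)

(* Defs.v *)
From HB Require Import structures.
From mathcomp Require Import all_boot finmap.

Set Implicit Arguments.
Unset Strict Implicit.
Unset Printing Implicit Defensive.

Local Open Scope fset_scope.

(* Signatures. A sort (symbol) that is not a theory sort (symbol) is a term
   sort (symbol). *)
Record signature := Signature {
  sort : eqType;
  theory_sort : pred sort;
  bool_sort : sort;
  symbol : Type;
  arity : symbol -> seq sort;
  result : symbol -> sort;
  theory_symbol : pred symbol;
  variable : choiceType;
  var_sort : variable -> sort;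
  bool_sort_theory : theory_sort bool_sort;
  theory_symbol_sorts : forall f, theory_symbol f ->
    theory_sort (result f) && all theory_sort (arity f)
}.

(* Since every element of an interpreted sort is itself a constant symbol, the
   carrier of a theory sort s is {v | value v /\ result v = s}; [interp f] maps
   lists of values to values and is only meaningful on theory symbols [f] and
   lists of values sorted according to [arity f]. *)
Record model (S : signature) := Model {
  value : pred (symbol S);
  interp : symbol S -> seq (symbol S) -> symbol S;
  value_theory : forall v, value v -> theory_symbol v;
  value_constant : forall v, value v -> arity v = [::];
  interp_value : forall v, value v -> interp v [::] = v;
  carrier_nonempty : forall s, theory_sort s ->
    exists v, value v /\ result v = s;
  interp_sorted : forall f vs, theory_symbol f ->
    all value vs -> map (@result S) vs = arity f ->
    value (interp f vs) /\ result (interp f vs) = result f;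
  (* the values of sort Bool are exactly the two values true and false *)
  truth : bool -> symbol S;
  truth_inj : injective truth;
  truthP : forall v,
    value v /\ result v = bool_sort S <-> exists b, v = truth b;
  neg : symbol S;
  conj : symbol S;
  disj : symbol S;
  impl : symbol S;
  eqn : sort S -> symbol S;
  neg_type : [/\ theory_symbol neg, arity neg = [:: bool_sort S]
    & result neg = bool_sort S];
  conj_type : [/\ theory_symbol conj,
    arity conj = [:: bool_sort S; bool_sort S] & result conj = bool_sort S];
  disj_type : [/\ theory_symbol disj,
    arity disj = [:: bool_sort S; bool_sort S] & result disj = bool_sort S];
  impl_type : [/\ theory_symbol impl,
    arity impl = [:: bool_sort S; bool_sort S] & result impl = bool_sort S];
  eqn_type : forall s, theory_sort s ->
    [/\ theory_symbol (eqn s), arity (eqn s) = [:: s; s]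
    & result (eqn s) = bool_sort S];
  neg_interp : forall a, interp neg [:: truth a] = truth (~~ a);
  conj_interp : forall a b,
    interp conj [:: truth a; truth b] = truth (a && b);
  disj_interp : forall a b,
    interp disj [:: truth a; truth b] = truth (a || b);
  impl_interp : forall a b,
    interp impl [:: truth a; truth b] = truth (a ==> b);
  eqn_interp : forall s u v, theory_sort s -> value u -> value v ->
    result u = s -> result v = s ->
    (interp (eqn s) [:: u; v] = truth true <-> u = v)
}.

(* Raw terms; terms proper are those satisfying [well_sorted]. *)
Inductive term (S : signature) :=
  | Var of variable S
  | App of symbol S & seq (term S).

Arguments Var {S}.
Arguments App {S}.

Definition sort_of (S : signature) (t : term S) : sort S :=
  match t with Var x => var_sort x | App f _ => result f end.

Fixpoint well_sorted (S : signature) (t : term S) : bool :=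
  match t with
  | Var _ => true
  | App f ts => all (@well_sorted S) ts && (map (@sort_of S) ts == arity f)
  end.

Fixpoint var_seq (S : signature) (t : term S) : seq (variable S) :=
  match t with
  | Var x => [:: x]
  | App _ ts => flatten (map (@var_seq S) ts)
  end.

Definition vars (S : signature) (t : term S) : {fset variable S} :=
  [fset x in var_seq t].

Definition linear (S : signature) (t : term S) : bool := uniq (var_seq t).

(* Positions are lists of argument indices, numbered from 0;
   [p] is a position of [t] iff [subterm t p] is not [None]. *)
Fixpoint subterm (S : signature) (t : term S) (p : seq nat) : option (term S) :=
  match p, t with
  | [::], _ => Some t
  | i :: q, App _ ts => obind (fun u => subterm u q) (onth ts i)
  | _ :: _, Var _ => None
  end.

(* s[u]_p, for p a position of s *)
Fixpoint replace (S : signature) (s : term S) (p : seq nat) (u : term S)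
    : term S :=
  match p, s with
  | [::], _ => u
  | i :: q, App f ts =>
      if onth ts i is Some v then App f (set_nth v ts i (replace v q u)) else s
  | _ :: _, Var _ => s
  end.

Definition function_position (S : signature) (s : term S) (p : seq nat) : Prop :=
  exists f ts, subterm s p = Some (App f ts).

Record subst (S : signature) := Subst {
  subst_fun :> variable S -> term S;
  subst_well_sorted : forall x, well_sorted (subst_fun x);
  subst_sort : forall x, sort_of (subst_fun x) = var_sort x
}.

Fixpoint apply (S : signature) (sigma : variable S -> term S) (t : term S)
    : term S :=
  match t with
  | Var x => sigma x
  | App f ts => App f (map (apply sigma) ts)
  end.

Definition has_dom (S : signature) (sigma : subst S) (X : {fset variable S})
    : Prop :=
  forall x, sigma x <> Var x <-> x \in X.

Definition is_value (S : signature) (M : model S) (t : term S) : bool :=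
  if t is App v [::] then value M v else false.

Definition valued (S : signature) (M : model S) (X : {fset variable S})
    (sigma : subst S) : Prop :=
  forall x, x \in X -> is_value M (sigma x).

Definition value_or_var_in (S : signature) (M : model S)
    (X : {fset variable S}) (t : term S) : Prop :=
  is_value M t \/ exists2 y, y \in X & t = Var y.

Fixpoint theory_term (S : signature) (t : term S) : bool :=
  match t with
  | Var _ => true
  | App f ts => theory_symbol f && all (@theory_term S) ts
  end.

Definition logical_constraint (S : signature) (phi : term S) : bool :=
  [&& well_sorted phi, theory_term phi & sort_of phi == bool_sort S].

(* The value given to a variable of a term sort is irrelevant: such variables
   do not occur in logical constraints. *)
Record valuation (S : signature) (M : model S) := Valuation {
  val_fun :> variable S -> symbol S;
  val_value : forall x, theory_sort (var_sort x) -> value M (val_fun x);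
  val_sort : forall x, theory_sort (var_sort x) ->
    result (val_fun x) = var_sort x
}.

Fixpoint eval (S : signature) (M : model S) (xi : variable S -> symbol S)
    (t : term S) : symbol S :=
  match t with
  | Var x => xi x
  | App f ts => interp M f (map (eval M xi) ts)
  end.

Definition holds (S : signature) (M : model S) (xi : valuation M)
    (phi : term S) : Prop :=
  eval M xi phi = truth M true.

Definition valid (S : signature) (M : model S) (phi : term S) : Prop :=
  forall xi : valuation M, holds xi phi.

Definition satisfiable (S : signature) (M : model S) (phi : term S) : Prop :=
  exists xi : valuation M, holds xi phi.

Definition conjunction (S : signature) (M : model S) (phi psi : term S)
    : term S :=
  App (conj M) [:: phi; psi].

Definition implication (S : signature) (M : model S) (phi psi : term S)
    : term S :=
  App (impl M) [:: phi; psi].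

(* Existential constraints: only the set of bound variables matters, not the
   order in which they are listed. *)
Record econstraint (S : signature) := EConstraint {
  bvars : {fset variable S};
  body : term S
}.

Definition econstraint_wf (S : signature) (c : econstraint S) : bool :=
  logical_constraint (body c) && (bvars c `<=` vars (body c)).

Definition fvars (S : signature) (c : econstraint S) : {fset variable S} :=
  vars (body c) `\` bvars c.

(* [theta] is the substitution {x |-> v} of values for the bound variables. *)
Definition eholds (S : signature) (M : model S) (xi : valuation M)
    (c : econstraint S) : Prop :=
  exists theta : subst S,
    [/\ valued M (bvars c) theta,
        forall x, x \notin bvars c -> theta x = Var x
      & holds xi (apply theta (body c))].

Definition evalid (S : signature) (M : model S) (c : econstraint S) : Prop :=
  forall xi : valuation M, eholds xi c.

Definition esatisfiable (S : signature) (M : model S) (c : econstraint S)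
    : Prop :=
  exists xi : valuation M, eholds xi c.

(* validity of the implication of two existential constraints *)
Definition eimplies (S : signature) (M : model S) (c d : econstraint S)
    : Prop :=
  forall xi : valuation M, eholds xi c -> eholds xi d.

(* (exists x. phi)sigma: sigma acts on the free variables only. No renaming of
   the bound variables is performed, so this is only correct when sigma cannot
   cause capture; it is used below for sigma closed on the free variables. *)
Definition esubst (S : signature) (sigma : subst S) (c : econstraint S)
    : econstraint S :=
  EConstraint (bvars c)
    (apply (fun x => if x \in bvars c then Var x else sigma x) (body c)).

Definition respects (S : signature) (M : model S) (sigma : subst S)
    (c : econstraint S) : Prop :=
  valued M (fvars c) sigma /\ evalid M (esubst sigma c).

(* existentially constrained terms  Pi X. s [exists x. phi] *)
Record ecterm (S : signature) := ECTerm {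
  ec_vars : {fset variable S};
  ec_term : term S;
  ec_constr : econstraint S;
  ec_term_sorted : well_sorted ec_term;
  ec_constr_wf : econstraint_wf ec_constr;
  ec_fvars_sub : fvars ec_constr `<=` ec_vars;
  ec_vars_sub : ec_vars `<=` vars ec_term;
  ec_bvars_disj : [disjoint bvars ec_constr & vars ec_term]
}.

Definition subsumed (S : signature) (M : model S) (T U : ecterm S) : Prop :=
  forall sigma : subst S,
    valued M (ec_vars T) sigma -> respects M sigma (ec_constr T) ->
    exists gamma : subst S,
      [/\ valued M (ec_vars U) gamma, respects M gamma (ec_constr U)
        & apply sigma (ec_term T) = apply gamma (ec_term U)].

(* constrained rewrite rules  Pi Z. l -> r [pi] *)
Record crule (S : signature) := CRule {
  rule_Z : {fset variable S};
  lhs : term S;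
  rhs : term S;
  guard : term S;
  lhs_sorted : well_sorted lhs;
  rhs_sorted : well_sorted rhs;
  lhs_rhs_sort : sort_of lhs = sort_of rhs;
  guard_logical : logical_constraint guard;
  rule_Z_sup : (vars rhs `\` vars lhs) `|` vars guard `<=` rule_Z;
  rule_Z_sub : rule_Z `<=` vars lhs `|` vars rhs `|` vars guard
}.

Definition rule_vars (S : signature) (rho : crule S) : {fset variable S} :=
  vars (lhs rho) `|` vars (rhs rho) `|` vars (guard rho).

Definition exvars (S : signature) (rho : crule S) : {fset variable S} :=
  vars (rhs rho) `\` vars (lhs rho).

Definition left_linear (S : signature) (rho : crule S) : bool :=
  linear (lhs rho).

Definition mg_step (S : signature) (M : model S) (rho : crule S)
    (T U : ecterm S) : Prop :=
  let X := ec_vars T in let s := ec_term T in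
  let phi := body (ec_constr T) in
  [/\ esatisfiable M (ec_constr T),
      left_linear rho,
      [disjoint rule_vars rho & vars s `|` vars phi]
    & exists (p : seq nat) (gamma : subst S),
        let pig := apply gamma (guard rho) in
        let t := replace s p (apply gamma (rhs rho)) in
        let psi := conjunction M phi pig in
        [/\ has_dom gamma (vars (lhs rho)),
            subterm s p = Some (apply gamma (lhs rho)),
            forall x, x \in vars (lhs rho) `&` rule_Z rho ->
              value_or_var_in M X (gamma x),
            eimplies M (ec_constr T)
              (EConstraint (vars (guard rho) `\` vars (lhs rho)) pig)
          & [/\ ec_term U = t,
                ec_constr U = EConstraint (vars psi `\` vars t) psi
              & ec_vars U = exvars rho `|` (X `&` vars t)]]].

(* non-quantified constrained terms  Pi X. s [phi] *)
Record cterm (S : signature) := CTerm {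
  ct_vars : {fset variable S};
  ct_term : term S;
  ct_constr : term S;
  ct_term_sorted : well_sorted ct_term;
  ct_constr_logical : logical_constraint ct_constr;
  ct_constr_sub : vars ct_constr `<=` ct_vars;
  ct_vars_sub : ct_vars `<=` vars ct_constr `|` vars ct_term
}.

Definition nq_step (S : signature) (M : model S) (rho : crule S)
    (T U : cterm S) : Prop :=
  let X := ct_vars T in let s := ct_term T in let phi := ct_constr T in
  [/\ satisfiable M phi,
      [disjoint rule_vars rho & X `|` (vars s `|` vars phi)]
    & exists (p : seq nat) (sigma : subst S),
        let t := replace s p (apply sigma (rhs rho)) in
        [/\ function_position s p,
            has_dom sigma (rule_vars rho),
            subterm s p = Some (apply sigma (lhs rho)),
            forall x, x \in rule_Z rho -> value_or_var_in M X (sigma x)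
          & [/\ valid M (implication M phi (apply sigma (guard rho))),
                ct_term U = t, ct_constr U = phi
              & ct_vars U = X `&` (vars t `|` vars phi)]]].

Section Extension.
Context (S : signature) (T : cterm S).

Let bv := vars (ct_constr T) `\` vars (ct_term T).
Let ec := EConstraint bv (ct_constr T).

Lemma ext_constr_wf : econstraint_wf ec.
Proof. by rewrite /econstraint_wf ct_constr_logical fsubsetDl. Qed.

Lemma ext_fvars_sub : fvars ec `<=` ct_vars T `\` bv.
Proof. exact: fsetSD (ct_constr_sub T). Qed.

Lemma ext_vars_sub : ct_vars T `\` bv `<=` vars (ct_term T).
Proof.
apply/fsubsetP => x; rewrite !in_fsetD => /andP[xNbv xX].
have := fsubsetP (ct_vars_sub T) x xX; rewrite in_fsetU.
by case: (x \in vars (ct_term T)) xNbv; case: (x \in vars (ct_constr T)).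
Qed.

Lemma ext_bvars_disj : [disjoint bvars ec & vars (ct_term T)].
Proof. by apply/fdisjointP => x; rewrite in_fsetD => /andP[]. Qed.

Definition ext : ecterm S :=
  ECTerm (ct_term_sorted T) ext_constr_wf ext_fvars_sub ext_vars_sub
    ext_bvars_disj.

End Extension.

(* Main.v *)
Require Import Defs.
From mathcomp Require Import all_boot finmap.

(* The most general step uses gamma, the restriction of the matching
   substitution sigma to the variables of the left-hand side. By freshness of
   the rule, sigma fixes s and phi and sigma \o gamma = sigma, so sigma maps the
   most general reduct to the reduct of the given step. Hence whatever
   instantiates the latter through delta instantiates the former through
   delta \o sigma. *)

Set Implicit Arguments.
Unset Strict Implicit.
Unset Printing Implicit Defensive.

Local Open Scope fset_scope.

(** Turns access and update at index [i] into a decomposition by concatenation, through which [map],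
    [flatten] and [all] distribute. *)
Lemma onth_split (A : Type) (s : seq A) (i : nat) (v : A) :
  onth s i = Some v ->
  exists s1 s2, s = s1 ++ v :: s2 /\
    forall w, set_nth v s i w = s1 ++ w :: s2.
Proof.
elim: s i => [|x s IHs] [|i] //=; first by case=> ->; exists [::], s.
by case/IHs=> [s1 [s2 [-> set_s]]]; exists (x :: s1), s2; split=> // w /=;
  rewrite set_s.
Qed.

(** * Terms: variables, positions, sorts and substitutions *)

Section Terms.
Context (S : signature).
Implicit Types (t u : term S) (x y : variable S).

(** The generated induction principle gives nothing for arguments nested in a list. The hypothesis
    on arguments is a [foldr] of conjunctions, since terms have no decidable equality for list
    membership, and it unfolds along an induction on the list. *)
Lemma term_nested_ind (P : term S -> Prop) :
    (forall x, P (Var x)) ->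
    (forall f ts, foldr (fun t => and (P t)) True ts -> P (App f ts)) ->
  forall t, P t.
Proof.
move=> PVar PApp; fix IH 1 => -[x|f ts]; first exact: PVar.
by apply: PApp; elim: ts => //= t ts IHts; split => //; exact: IH.
Qed.

Lemma mem_vars t x : (x \in vars t) = (x \in var_seq t).
Proof. by rewrite in_fset. Qed.

Lemma eq_apply (g h : variable S -> term S) t :
  (forall x, x \in vars t -> g x = h x) -> apply g t = apply h t.
Proof.
move=> gh; have {}gh x : x \in var_seq t -> g x = h x.
  by rewrite -mem_vars; apply: gh.
elim/term_nested_ind: t gh => [x|f ts IHts] gh /=; first by rewrite gh ?inE.
congr App; elim: ts IHts gh => //= t ts IH [IHt /IH{}IH] gh.
rewrite IHt => [|x xt]; last by rewrite gh // mem_cat xt.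
by rewrite IH // => x xts; rewrite gh //= mem_cat xts orbT.
Qed.

Lemma apply_Var t : apply Var t = t.
Proof.
elim/term_nested_ind: t => //= f ts IHts; congr App.
by elim: ts IHts => //= t ts IH [-> /IH->].
Qed.

Lemma apply_id (g : variable S -> term S) t :
  (forall x, x \in vars t -> g x = Var x) -> apply g t = t.
Proof. by move=> /eq_apply->; apply: apply_Var. Qed.

Lemma apply_comp (g h : variable S -> term S) t :
  apply g (apply h t) = apply (fun x => apply g (h x)) t.
Proof.
elim/term_nested_ind: t => //= f ts IHts; congr App.
by elim: ts IHts => //= t ts IH [-> /IH->].
Qed.

Lemma var_seq_apply (g : variable S -> term S) t :
  var_seq (apply g t) = flatten [seq var_seq (g x) | x <- var_seq t].
Proof.
elim/term_nested_ind: t => [x|f ts IHts] /=; first by rewrite cats0.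
elim: ts IHts => //= t ts IH [-> /IH->].
by rewrite map_cat flatten_cat.
Qed.

Lemma vars_applyP (g : variable S -> term S) t x :
  reflect (exists2 y, y \in vars t & x \in vars (g y)) (x \in vars (apply g t)).
Proof.
rewrite mem_vars var_seq_apply; apply: (iffP flatten_mapP) => -[y yt xy];
  by exists y; rewrite ?mem_vars // -mem_vars.
Qed.

Lemma subterm_vars t p u :
  subterm t p = Some u -> vars u `<=` vars t.
Proof.
move=> tp; apply/fsubsetP => x; rewrite !mem_vars.
elim: p t tp => [|i p IHp] [y|f ts] //=; try by case=> <-.
case tsi: (onth ts i) => [v|] //= /IHp xv xu.
have [s1 [s2 [-> _]]] := onth_split tsi.
by rewrite map_cat flatten_cat !mem_cat xv ?orbT.
Qed.

Lemma vars_replace_sub t p u :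
  vars (replace t p u) `<=` vars t `|` vars u.
Proof.
apply/fsubsetP => x; rewrite in_fsetU !mem_vars.
elim: p t => [|i p IHp] [y|f ts] /=; try by move=> ->; rewrite ?orbT.
case tsi: (onth ts i) => [v|] /= => [|->//].
have [s1 [s2 [-> ->]]] := onth_split tsi.
rewrite !map_cat !flatten_cat !mem_cat.
by case/or3P => [->|/IHp/orP[]->|->]; rewrite ?orbT.
Qed.

Lemma vars_replace_sup t p u v :
  subterm t p = Some v -> vars u `<=` vars (replace t p u).
Proof.
move=> tp; apply/fsubsetP => x; rewrite !mem_vars.
elim: p t tp => [|i p IHp] [y|f ts] //=.
case tsi: (onth ts i) => [w|] //= /IHp xw xu.
have [s1 [s2 [_ ->]]] := onth_split tsi.
by rewrite map_cat flatten_cat !mem_cat xw ?orbT.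
Qed.

(** The hypothesis makes [p] a position: a path running below a variable of [t] is ignored by
    [replace], yet may exist in [apply g t]. *)
Lemma apply_replace (g : variable S -> term S) t p u v :
    subterm t p = Some v ->
  apply g (replace t p u) = replace (apply g t) p (apply g u).
Proof.
elim: p t => [|i p IHp] [y|f ts] //=.
have -> : onth [seq apply g w | w <- ts] i = omap (apply g) (onth ts i).
  by elim: ts i => [|w ts IHts] [|i] /=.
case tsi: (onth ts i) => [w|] //= /IHp IHw.
by rewrite -IHw; congr App; elim: ts i tsi => [|w' ts IHts] [|i] //= /IHts->.
Qed.

Lemma sort_of_replace t p u v :
  subterm t p = Some v -> sort_of u = sort_of v ->
  sort_of (replace t p u) = sort_of t.
Proof.
case: p t => [|i p] [y|f ts] //= => [[<-]|[<-]|] //.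
by case: (onth ts i).
Qed.

Lemma well_sorted_replace t p u v :
    subterm t p = Some v -> sort_of u = sort_of v ->
  well_sorted t -> well_sorted u -> well_sorted (replace t p u).
Proof.
move=> + uv + wu; elim: p t => [|i p IHp] [y|f ts] //=.
case tsi: (onth ts i) => [w|] //= wp.
have := sort_of_replace wp uv.
have [s1 [s2 [-> ->]]] := onth_split tsi => sort_w.
rewrite /= !all_cat /= !map_cat /= sort_w => /andP[/and3P[-> ww ->] ->].
by rewrite (IHp _ wp ww).
Qed.

Lemma sort_of_apply (sigma : subst S) t : sort_of (apply sigma t) = sort_of t.
Proof. by case: t => //= x; apply: subst_sort. Qed.

Lemma well_sorted_apply (sigma : subst S) t :
  well_sorted t -> well_sorted (apply sigma t).
Proof.
elim/term_nested_ind: t => [x _|f ts IHts] /=; first exact: subst_well_sorted.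
case/andP=> wts /eqP <-; rewrite -map_comp (eq_map (sort_of_apply sigma)) eqxx.
by rewrite andbT; elim: ts IHts wts => //= t ts IH [IHt /IH{}IH] /andP[/IHt->].
Qed.

Lemma theory_term_apply (g : variable S -> term S) t :
    (forall x, x \in vars t -> theory_term (g x)) ->
  theory_term t -> theory_term (apply g t).
Proof.
move=> gth; have {}gth x : x \in var_seq t -> theory_term (g x).
  by rewrite -mem_vars; apply: gth.
elim/term_nested_ind: t gth => [x|f ts IHts] gth /=.
  by rewrite gth ?inE.
case/andP=> -> /=; elim: ts IHts gth => //= t ts IH [IHt /IH{}IH] gth.
case/andP=> /IHt-> => [|x xt]; last by rewrite gth //= mem_cat xt.
by apply: IH => // x xts; rewrite gth //= mem_cat xts orbT.
Qed.

(** Arguments of theory symbols have theory sorts, so this property descends from the root to the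
    leaves. It ensures that valuations are meaningful on the variables of a constraint. *)
Lemma logical_vars_theory phi x :
  logical_constraint phi -> x \in vars phi -> theory_sort (var_sort x).
Proof.
case/and3P=> wphi tphi /eqP sphi; rewrite mem_vars.
(* The induction needs an arbitrary theory sort at the root, since subterms need not be Boolean. *)
have: theory_sort (sort_of phi) by rewrite sphi bool_sort_theory.
elim/term_nested_ind: phi wphi tphi {sphi} => [y _ _ sy|f ts IHts] /=.
  by rewrite inE => /eqP->.
case/andP=> wts /eqP sts /andP[/theory_symbol_sorts/andP[_]].
rewrite -sts => + + _; elim: ts IHts wts {sts} => //= t ts IH [IHt /IH{}IH].
case/andP=> wt wts /andP[st sts] /andP[tt tts]; rewrite mem_cat.
by case/orP=> [|/IH]; [apply: IHt | apply].
Qed.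

Definition id_subst : subst S := @Subst S Var (fun=> isT) (fun=> erefl).

(** With the identity as [h] or as [g], this restricts a substitution to [X] or to its
    complement. *)
Program Definition mix_subst (X : {fset variable S}) (g h : subst S) :
    subst S :=
  @Subst S (fun x => if x \in X then g x else h x) _ _.
Next Obligation. by case: ifP => _; apply: subst_well_sorted. Qed.
Next Obligation. by case: ifP => _; apply: subst_sort. Qed.

Program Definition comp_subst (g h : subst S) : subst S :=
  @Subst S (fun x => apply g (h x)) _ _.
Next Obligation. exact/well_sorted_apply/subst_well_sorted. Qed.
Next Obligation. by rewrite sort_of_apply subst_sort. Qed.

(** [has_dom] yields only a double negation. It is removed by inspecting [sigma x], because equality
    of variables is decidable while that of terms is not. *)
Lemma has_dom_id (sigma : subst S) X x :
  has_dom sigma X -> x \notin X -> sigma x = Var x.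
Proof.
move=> domX xX; have: ~ (sigma x <> Var x) by move=> /domX; apply/negP.
case: (sigma x) => [y|f ts] nn; last by case: nn.
by case: (y =P x) => [->//|yx]; case: nn; case.
Qed.

End Terms.

(** * Evaluation, valuations and existential constraints *)

Section Semantics.
Context (S : signature) (M : model S).
Implicit Types (t u : term S) (x y : variable S) (xi : valuation M).

Lemma is_valueP t :
  reflect (exists2 v, t = App v [::] & value M v) (is_value M t).
Proof.
case: t => [x|f [|t ts]] /=; try by constructor; case.
by apply: (iffP idP) => [fv|[v [<-]]//]; exists f.
Qed.

Lemma eq_eval (f g : variable S -> symbol S) t :
  (forall x, x \in vars t -> f x = g x) -> eval M f t = eval M g t.
Proof.
move=> fg; have {}fg x : x \in var_seq t -> f x = g x.
  by rewrite -mem_vars; apply: fg.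
elim/term_nested_ind: t fg => [x|h ts IHts] fg /=; first by rewrite fg ?inE.
congr interp; elim: ts IHts fg => //= t ts IH [IHt /IH{}IH] fg.
rewrite IHt => [|x xt]; last by rewrite fg // mem_cat xt.
by rewrite IH // => x xts; rewrite fg //= mem_cat xts orbT.
Qed.

Lemma eval_apply (f : variable S -> symbol S) g t :
  eval M f (apply g t) = eval M (fun x => eval M f (g x)) t.
Proof.
elim/term_nested_ind: t => //= h ts IHts; congr interp.
by elim: ts IHts => //= t ts IH [-> /IH->].
Qed.

Lemma is_value_apply g t : is_value M t -> apply g t = t.
Proof. by case/is_valueP=> v ->. Qed.

Lemma is_value_vars t x : is_value M t -> x \in vars t = false.
Proof. by case/is_valueP=> v -> _; rewrite mem_vars. Qed.

Lemma is_value_theory t : is_value M t -> theory_term t.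
Proof. by case/is_valueP=> v -> /value_theory /= ->. Qed.

Lemma is_value_eval f g t : is_value M t -> eval M f t = eval M g t.
Proof. by case/is_valueP=> v ->. Qed.

Definition in_carrier (s : Defs.sort S) (v : symbol S) : Prop :=
  value M v /\ result v = s.

Lemma is_value_carrier f t :
  is_value M t -> in_carrier (sort_of t) (eval M f t).
Proof. by case/is_valueP=> v -> vv /=; rewrite interp_value. Qed.

Lemma valuation_carrier xi x :
  theory_sort (var_sort x) -> in_carrier (var_sort x) (xi x).
Proof. by move=> tx; split; [apply: val_value | apply: val_sort]. Qed.

(** By induction, every well-sorted theory term evaluates into the carrier of its sort; by [truthP],
    the carrier of Bool consists of the two truth values. *)
Lemma logical_eval_bool (f : variable S -> symbol S) phi :
    logical_constraint phi ->
    (forall x, x \in vars phi -> in_carrier (var_sort x) (f x)) ->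
  exists b, eval M f phi = truth M b.
Proof.
case/and3P=> wphi tphi /eqP sphi fval; apply/truthP; rewrite -sphi.
have {}fval x : x \in var_seq phi -> in_carrier (var_sort x) (f x).
  by rewrite -mem_vars; apply: fval.
rewrite -/(in_carrier _ _).
elim/term_nested_ind: phi wphi tphi {sphi} fval => [x _ _|h ts IHts] /=.
  by apply; rewrite inE.
case/andP=> wts /eqP sts /andP[th tts] fval.
have [vts rts] : all (value M) (map (eval M f) ts) /\
    map (@result S) (map (eval M f) ts) = map (@sort_of S) ts.
  elim: ts IHts wts tts fval {sts} => //= t ts IH [IHt /IH{}IH].
  case/andP=> wt wts /andP[tt tts] fval.
  have [|||-> ->] // := IHt.
    by move=> x xt; apply: fval; rewrite mem_cat xt.
  have [|||-> ->] // := IH.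
  by move=> x xt; apply: fval; rewrite mem_cat xt orbT.
by apply: interp_sorted => //; rewrite rts.
Qed.

Section Update.
Context (xi : valuation M) (tau : subst S).

(** Absorbs [tau] into the valuation. Falling back on [xi] where [tau x] is not a value keeps the
    result a valuation, as arbitrary terms need not evaluate into a carrier. *)
Let updated x := if is_value M (tau x) then eval M xi (tau x) else xi x.

Lemma update_carrier x :
  theory_sort (var_sort x) -> in_carrier (var_sort x) (updated x).
Proof.
rewrite /updated => tx; case: ifP => [/(is_value_carrier xi)|_].
  by rewrite subst_sort.
exact: valuation_carrier.
Qed.

Definition update : valuation M :=
  @Valuation S M updated (fun x tx => proj1 (update_carrier tx))
    (fun x tx => proj2 (update_carrier tx)).

End Update.

Lemma holds_update xi (tau : subst S) phi :
    (forall x, x \in vars phi -> is_value M (tau x) \/ tau x = Var x) ->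
  holds (update xi tau) phi <-> holds xi (apply tau phi).
Proof.
move=> tauP; rewrite /holds eval_apply (@eq_eval _ (update xi tau)) // => x.
by move=> /tauP[|] /= => [->|->].
Qed.

(** Replaces the witnessing substitution by a changed valuation, so that later arguments only
    compare valuations. *)
Lemma eholds_valuation xi (c : econstraint S) :
  eholds xi c ->
  exists xi' : valuation M,
    (forall x, x \notin bvars c -> xi' x = xi x) /\ holds xi' (body c).
Proof.
case=> theta [thv thx thb]; exists (update xi theta).
split=> [x xb|]; first by rewrite /= (thx x xb).
apply/holds_update => // x _.
by case: (boolP (x \in bvars c)) => [/thv|/thx]; [left | right].
Qed.

Program Definition value_subst (X : {fset variable S})
    (f : variable S -> symbol S) : subst S :=
  @Subst S (fun x => if [&& x \in X, value M (f x)
      & result (f x) == var_sort x] then App (f x) [::] else Var x) _ _.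
Next Obligation. by case: ifP => //= /and3P[_ /value_constant->]. Qed.
Next Obligation. by case: ifP => //= /and3P[_ _ /eqP]. Qed.

(** Converse of [eholds_valuation]. Here [f] is a mere function, because it will be [xi] composed
    with a substitution, whose images may contain term symbols and so need not evaluate into
    carriers outside the constraint. *)
Lemma eholdsI xi (c : econstraint S) (f : variable S -> symbol S) :
    (forall x, x \in bvars c -> in_carrier (var_sort x) (f x)) ->
    (forall x, x \in fvars c -> f x = xi x) ->
    eval M f (body c) = truth M true ->
  eholds xi c.
Proof.
move=> fb ff fc; exists (value_subst (bvars c) f); split.
- by move=> x xb; case: (fb x xb) => fv fr /=; rewrite xb fv fr eqxx.
- by move=> x /negbTE xb /=; rewrite xb.
rewrite /holds eval_apply -fc; apply: eq_eval => x xc /=.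
case: (boolP (x \in bvars c)) => [xb|xb] /=.
  by case: (fb x xb) => fv fr; rewrite fv fr eqxx /= interp_value.
by rewrite ff // in_fsetD xb.
Qed.

(** The interpretation of [impl] is specified on truth values only, so [psi] must first be known to
    evaluate to one. *)
Lemma valid_implication xi phi psi :
    logical_constraint psi -> valid M (implication M phi psi) ->
  holds xi phi -> holds xi psi.
Proof.
move=> lpsi /(_ xi); rewrite /holds /= => impl_true phi_true.
case: (@logical_eval_bool xi psi lpsi) impl_true => [x xpsi|b ->].
  exact/valuation_carrier/(logical_vars_theory lpsi).
by rewrite phi_true impl_interp.
Qed.

Lemma vars_conjunction phi psi :
  vars (conjunction M phi psi) = vars phi `|` vars psi.
Proof.
by apply/fsetP=> x; rewrite in_fsetU !mem_vars /= !mem_cat in_nil orbF.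
Qed.

Lemma logical_conjunction phi psi :
    logical_constraint phi -> logical_constraint psi ->
  logical_constraint (conjunction M phi psi).
Proof.
have [tc ac rc] := conj_type M.
case/and3P=> wphi tphi /eqP sphi /and3P[wpsi tpsi /eqP spsi].
by rewrite /logical_constraint /= wphi wpsi tphi tpsi tc ac rc sphi spsi !eqxx.
Qed.

Lemma logical_apply X (sigma : subst S) phi :
    (forall x, x \in vars phi -> value_or_var_in M X (sigma x)) ->
  logical_constraint phi -> logical_constraint (apply sigma phi).
Proof.
move=> sv /and3P[wphi tphi sphi].
rewrite /logical_constraint well_sorted_apply // sort_of_apply sphi andbT.
apply: theory_term_apply => // x /sv[|[y _ ->//]]; exact: is_value_theory.
Qed.

End Semantics.

(** * The most general reduct of the extension *)

Section RewriteStep.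
Context (S : signature) (M : model S) (rho : crule S) (T : cterm S).
Context (p : seq nat) (sigma : subst S).
Let X := ct_vars T.
Let s := ct_term T.
Let phi := ct_constr T.
Context (fresh : [disjoint rule_vars rho & X `|` (vars s `|` vars phi)]).
Context (sigma_dom : has_dom sigma (rule_vars rho)).
Context (s_p : subterm s p = Some (apply sigma (lhs rho))).
Context (sigma_Z :
  forall x, x \in rule_Z rho -> value_or_var_in M X (sigma x)).
Context (phi_guard : valid M (implication M phi (apply sigma (guard rho)))).

Let gamma := mix_subst (vars (lhs rho)) sigma (id_subst S).
Let pig := apply gamma (guard rho).
Let t := replace s p (apply gamma (rhs rho)).
Let psi := conjunction M phi pig.
Let bv := vars phi `\` vars s.
Let gbv := vars (guard rho) `\` vars (lhs rho).

Let sigma_out x : x \in X `|` (vars s `|` vars phi) -> sigma x = Var x.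
Proof.
move=> xT; apply: (has_dom_id sigma_dom).
by apply/negP => /(fdisjointP fresh); rewrite xT.
Qed.

Let sigma_s x : x \in vars s -> sigma x = Var x.
Proof. by move=> xs; apply: sigma_out; rewrite !in_fsetU xs orbT. Qed.

Let sigma_X x : x \in X -> sigma x = Var x.
Proof. by move=> xs; apply: sigma_out; rewrite !in_fsetU xs. Qed.

Let sigma_phi x : x \in vars phi -> sigma x = Var x.
Proof. by move=> xs; apply: sigma_out; rewrite !in_fsetU xs !orbT. Qed.

Let rule_out x : x \in rule_vars rho ->
  [/\ x \notin X, x \notin vars s & x \notin vars phi].
Proof. by move=> /(fdisjointP fresh); rewrite !in_fsetU !negb_or => /and3P. Qed.

Let guard_Z x : x \in vars (guard rho) -> x \in rule_Z rho.
Proof.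
by move=> xg; apply: (fsubsetP (rule_Z_sup rho)); rewrite in_fsetU xg orbT.
Qed.

Let exvars_Z x : x \in exvars rho -> x \in rule_Z rho.
Proof.
by move=> xg; apply: (fsubsetP (rule_Z_sup rho)); rewrite in_fsetU xg.
Qed.

Let gbv_rule x : x \in gbv -> x \in rule_vars rho.
Proof. by rewrite in_fsetD !in_fsetU => /andP[_ ->]; rewrite !orbT. Qed.

Let lhs_vars x y : y \in vars (lhs rho) -> x \in vars (sigma y) -> x \in vars s.
Proof.
move=> yl xy; apply: (fsubsetP (subterm_vars s_p)).
by apply/vars_applyP; exists y.
Qed.

Let gamma_lhs : apply gamma (lhs rho) = apply sigma (lhs rho).
Proof. by apply: eq_apply => x /= ->. Qed.

(** For [x] in the left-hand side, [sigma x] lies inside the matched subterm of [s], whose variables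
    [sigma] fixes. *)
Let sigma_gamma u : apply sigma (apply gamma u) = apply sigma u.
Proof.
rewrite apply_comp; apply: eq_apply => x _ /=; case: ifP => // xl.
by apply: apply_id => y /(lhs_vars xl)/sigma_s.
Qed.

Let gamma_vars u x : x \in vars (apply gamma u) ->
  x \in vars u `\` vars (lhs rho) \/
  exists2 y, y \in vars u `&` vars (lhs rho) & x \in vars (sigma y).
Proof.
case/vars_applyP => y yu /=; case: ifP => yl xy.
  by right; exists y; rewrite ?in_fsetI ?yu.
by left; move: xy; rewrite mem_vars mem_seq1 in_fsetD => /eqP->; rewrite yl yu.
Qed.

(** Guard variables belong to [rule_Z], so those matched by the left-hand side become values, which
    have no variables, or variables of [X]. *)
Let pig_vars x : x \in vars pig ->
  x \in gbv \/ x \in vars s /\ x \in X.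
Proof.
case/gamma_vars => [|[y /fsetIP[yg yl] xy]]; [by left | right].
split; first exact: lhs_vars xy.
case: (sigma_Z (guard_Z yg)) xy => [/is_value_vars->//|[z zX ->]].
by rewrite mem_vars mem_seq1 => /eqP->.
Qed.

Let t_vars x : x \in vars t -> x \in vars s \/ x \in exvars rho.
Proof.
move=> /(fsubsetP (vars_replace_sub _ _ _))/fsetUP[|]; first by left.
by case/gamma_vars => [|[y /fsetIP[_ yl] /(lhs_vars yl)]]; [right | left].
Qed.

Let exvars_t x : x \in exvars rho -> x \in vars t.
Proof.
move=> xe; apply: (fsubsetP (vars_replace_sup _ s_p)).
case/fsetDP: xe => [xr xl]; apply/vars_applyP; exists x => //=.
by rewrite (negbTE xl) mem_vars mem_seq1.
Qed.

Let sigma_t : apply sigma t = replace s p (apply sigma (rhs rho)).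
Proof.
rewrite (apply_replace sigma _ s_p) sigma_gamma.
by rewrite (apply_id (t := s)) // => x; apply: sigma_s.
Qed.

Let sigma_psi : apply sigma psi = conjunction M phi (apply sigma (guard rho)).
Proof.
rewrite /= sigma_gamma (apply_id (t := phi)) // => x; exact: sigma_phi.
Qed.

Let pig_logical : logical_constraint pig.
Proof.
apply: (@logical_apply _ M (X `|` gbv)) (guard_logical rho) => x xg.
rewrite /=; case: ifPn => xl; last first.
  by right; exists x; rewrite // in_fsetU orbC in_fsetD xl xg.
case: (sigma_Z (guard_Z xg)) => [|[y yX ->]]; first by left.
by right; exists y; rewrite // in_fsetU yX.
Qed.

Let sigma_guard_logical : logical_constraint (apply sigma (guard rho)).
Proof.
exact: logical_apply (fun x xg => sigma_Z (guard_Z xg)) (guard_logical rho).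
Qed.

Let psi_logical : logical_constraint psi.
Proof. exact: logical_conjunction (ct_constr_logical T) pig_logical. Qed.

Let sort_gamma_rhs :
  sort_of (apply gamma (rhs rho)) = sort_of (apply sigma (lhs rho)).
Proof. by rewrite !sort_of_apply lhs_rhs_sort. Qed.

Let reduct_vars := exvars rho `|` ((X `\` bv) `&` vars t).
Let reduct_constr := EConstraint (vars psi `\` vars t) psi.

Let reduct_sorted : well_sorted t.
Proof.
apply: well_sorted_replace s_p sort_gamma_rhs (ct_term_sorted T) _.
exact: well_sorted_apply (rhs_sorted rho).
Qed.

Let reduct_constr_wf : econstraint_wf reduct_constr.
Proof. by rewrite /econstraint_wf psi_logical fsubsetDl. Qed.

(** A variable of [t] that is not an extra variable of the rule occurs in [s]. If it comes from
    [phi] it is in [X]; if it comes from the guard it cannot be a rule variable, by freshness, so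
    [pig_vars] puts it in [X]. *)
Let reduct_fvars x : x \in vars psi -> x \in vars t -> x \in reduct_vars.
Proof.
rewrite vars_conjunction in_fsetU => xpsi xt; rewrite in_fsetU.
case: (boolP (x \in exvars rho)) => //= xe.
have xs : x \in vars s by case: (t_vars xt) => // xe'; rewrite xe' in xe.
rewrite in_fsetI xt andbT !in_fsetD xs /=.
case/orP: xpsi => [|/pig_vars[/gbv_rule/rule_out[_]|[]//]].
  exact: (fsubsetP (ct_constr_sub T)).
by rewrite xs.
Qed.

Let reduct_fvars_sub : fvars reduct_constr `<=` reduct_vars.
Proof.
(* The free variables are those of [psi] that also occur in [t]. *)
apply/fsubsetP => x; rewrite !in_fsetD negb_and negbK andb_orl.
by case/orP=> /andP[]; [move=> xt xpsi; apply: reduct_fvars | move=> /negP].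
Qed.

Let reduct_vars_sub : reduct_vars `<=` vars t.
Proof.
apply/fsubsetP => x /fsetUP[/exvars_t//|].
by rewrite in_fsetI => /andP[].
Qed.

Let reduct_bvars_disj : [disjoint bvars reduct_constr & vars t].
Proof. by apply/fdisjointP => x; rewrite in_fsetD => /andP[]. Qed.

Definition reduct : ecterm S :=
  ECTerm reduct_sorted reduct_constr_wf reduct_fvars_sub reduct_vars_sub
    reduct_bvars_disj.

Lemma ext_mg_step :
  left_linear rho -> satisfiable M phi -> mg_step M rho (ext T) reduct.
Proof.
move=> linear_rho [xi0 phi_xi0]; split=> //.
- exists xi0; apply: (@eholdsI _ _ _ _ xi0) => // x.
  rewrite in_fsetD => /andP[_ xphi].
  exact/valuation_carrier/(logical_vars_theory (ct_constr_logical T)).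
- by apply: fdisjointWr fresh; apply: fsubsetUr.
exists p, gamma; split=> //.
- move=> x /=; case: ifP => xl; last by split.
  by split=> // _; apply/sigma_dom; rewrite !in_fsetU xl.
- by rewrite gamma_lhs.
- move=> x /fsetIP[xl xZ] /=; rewrite xl.
  case: (sigma_Z xZ) => [|[y yX sx]]; [by left | right; exists y => //].
  (* The variable [y] occurs in [s], hence is not bound in [ext T] and stays in its variable set. *)
  rewrite !in_fsetD yX andbT negb_and negbK.
  by rewrite (lhs_vars xl) // sx mem_vars mem_seq1.
move=> xi /eholds_valuation[xi' [xi'E phi_xi']].
have guard_xi' := valid_implication sigma_guard_logical phi_guard phi_xi'.
(* Since [xi'] satisfies the guard under [sigma], each bound guard variable [x] takes the value of
   [sigma x] under [xi']. *)
apply: (@eholdsI _ _ _ _ (fun x => eval M xi' (sigma x))).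
- move=> x /= xg; have tx : theory_sort (var_sort x).
    apply: (logical_vars_theory (guard_logical rho)).
    by move: xg; rewrite in_fsetD => /andP[].
  have xZ : x \in rule_Z rho.
    by apply: guard_Z; move: xg; rewrite in_fsetD => /andP[].
  rewrite -(subst_sort sigma x) in tx *.
  case: (sigma_Z xZ) tx => [/is_value_carrier//|[y _ ->]].
  exact: valuation_carrier.
(* A free variable of [pig] occurs in [s]: [sigma] fixes it, and [xi'] agrees with [xi] there. *)
- move=> x; rewrite in_fsetD => /andP[/= xg /pig_vars[]].
    by move=> xg'; rewrite xg' in xg.
  by case=> xs _; rewrite sigma_s //= xi'E // in_fsetD xs.
by rewrite -eval_apply /= sigma_gamma.
Qed.

(* delta \o sigma is the witness for the reduct: its constraint psi satisfies
   sigma psi = phi /\ sigma pi, so a valuation xi2 of phi extending delta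
   provides the values xi2 (sigma x) for the bound variables of psi. *)
Lemma ext_subsumed_reduct (U : cterm S) :
    ct_term U = replace s p (apply sigma (rhs rho)) -> ct_constr U = phi ->
    ct_vars U = X `&` (vars (ct_term U) `|` vars phi) ->
  subsumed M (ext U) reduct.
Proof.
move=> tU phiU XU delta deltaX [_ delta_phi]; rewrite /= in deltaX *.
set bvU := vars (ct_constr U) `\` vars (ct_term U) in deltaX.
have delta_val y : y \in X -> y \in vars (ct_term U) -> is_value M (delta y).
  move=> yX yt; apply: deltaX.
  by rewrite !in_fsetD yt /= XU in_fsetI yX in_fsetU yt.
have sigma_t_vars x y : x \in vars t -> y \in vars (sigma x) ->
    y \in vars (ct_term U).
  by move=> xt yx; rewrite tU -sigma_t; apply/vars_applyP; exists x.
(* The witness is valued on the reduct's variables: [sigma] sends each to a value or to a variable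
   of [X] surviving in the term of [U], where [delta] is valued. *)
have val_reduct x : x \in reduct_vars -> is_value M (apply delta (sigma x)).
  case/fsetUP => [xe|].
    case: (sigma_Z (exvars_Z xe)) => [xv|[y yX sx]].
      by rewrite (is_value_apply _ xv).
    rewrite sx /=; apply: delta_val => //; apply: (sigma_t_vars x).
      exact: exvars_t.
    by rewrite sx mem_vars mem_seq1.
  case/fsetIP=> /fsetDP[xX _] xt; rewrite (sigma_X xX) /=.
  apply: delta_val => //.
  by apply: (sigma_t_vars x) => //; rewrite sigma_X // mem_vars mem_seq1.
exists (comp_subst delta sigma); split=> //; last first.
  by rewrite -apply_comp sigma_t -tU.
split=> [x /(fsubsetP reduct_fvars_sub)/val_reduct//|xi].
have [xi1 [_ phi_xi1]] := eholds_valuation (delta_phi xi).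
(* [tau] is the capture-avoiding action of [delta] in [esubst]: [xi2] keeps the values of [xi1] on
   bound variables and takes those of [delta] on the free ones. *)
pose tau := mix_subst bvU (id_subst S) delta.
pose xi2 := update xi1 tau.
have phi_xi2 : holds xi2 phi.
  rewrite -phiU; apply/holds_update => [x xphi|]; last exact: phi_xi1.
  rewrite /= in_fsetD xphi andbT; case: ifPn => xt; [by right | left].
  apply: delta_val; last by rewrite negbK in xt.
  by apply: (fsubsetP (ct_constr_sub T)); rewrite -/phi -phiU.
have guard_xi2 := valid_implication sigma_guard_logical phi_guard phi_xi2.
have psi_xi2 : eval M (fun x => eval M xi2 (sigma x)) psi = truth M true.
  by rewrite -eval_apply sigma_psi /= phi_xi2 guard_xi2 conj_interp.
have psi_val x : x \in vars psi -> value_or_var_in M (X `|` vars phi) (sigma x).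
  rewrite vars_conjunction => /fsetUP[xphi|/pig_vars[|[_ xX]]].
  - by right; exists x; rewrite ?sigma_phi // in_fsetU xphi orbT.
  - rewrite in_fsetD => /andP[_ /guard_Z/sigma_Z[|[y yX ->]]]; first by left.
    by right; exists y; rewrite // in_fsetU yX.
  - by right; exists x; rewrite ?sigma_X // in_fsetU xX.
apply: (@eholdsI _ _ _ _ (fun x => eval M xi2 (sigma x))).
- move=> x /=; rewrite in_fsetD => /andP[_ xpsi].
  have := logical_vars_theory psi_logical xpsi; rewrite -(subst_sort sigma x).
  case: (psi_val x xpsi) => [/is_value_carrier//|[y _ ->]].
  exact: (valuation_carrier xi2).
(* The instantiated constraint has no free variable: a bound [y] is left in place and stays bound,
   and a free [y] becomes a value by [val_reduct]. *)
- move=> x /fsetDP[/(@vars_applyP _ _ psi)[y ypsi] + /=].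
  case: ifPn => [yb|yb].
    by rewrite mem_vars mem_seq1 => /eqP->; rewrite yb.
  rewrite (@is_value_vars _ M) //; apply: val_reduct.
  by apply: reduct_fvars => //; move: yb; rewrite in_fsetD ypsi andbT negbK.
(* It remains to compare both evaluations variable by variable. On a free [x], either [sigma x] is a
   value, or it is a variable [y] of the term of [U], on which [xi2] takes the value [delta y]. *)
rewrite -psi_xi2; apply: etrans (@eval_apply _ _ _ _ psi) _.
apply: eq_eval => x xpsi /=; case: ifPn => // xb.
have xt : x \in vars t by move: xb; rewrite in_fsetD xpsi andbT negbK.
case: (psi_val x xpsi) => [xv|[y yX sx]].
  by rewrite (is_value_apply _ xv); apply: is_value_eval xv.
have yt : y \in vars (ct_term U).
  by apply: (sigma_t_vars x) => //; rewrite sx mem_vars mem_seq1.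
have {}yX : y \in X.
  by case/fsetUP: yX => // /(fsubsetP (ct_constr_sub T)).
have yv := delta_val y yX yt.
by rewrite sx /= in_fsetD yt /= yv; apply: is_value_eval.
Qed.

End RewriteStep.

Theorem mainTheorem3 (S : signature) (M : model S) (rho : crule S)
    (rho_left_linear : left_linear rho) (T U : cterm S) :
  nq_step M rho T U ->
  exists u : ecterm S, mg_step M rho (ext T) u /\ subsumed M (ext U) u.
Proof.
case=> phi_sat fresh [p [sigma [_ dom s_p sigma_Z [phi_guard tU phiU XU]]]].
exists (reduct fresh s_p sigma_Z); split.
  exact: ext_mg_step.
by apply: ext_subsumed_reduct; rewrite ?tU.
Qed.
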